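(* Let $m_u>0$, $X_u,X_{u|u|}\in\mathbb R$, $\bar V_d^{\max},V_{cM}>0$, $\bar u_{r,\max}=\bar V_d^{\max}+V_{cM}$, $\mathcal I_u=\{s\in\mathbb R:|s|\le\bar u_{r,\max}\}$, and $$L_{\rm drag}:=|X_u|+2|X_{u|u|}|\bar u_{r,\max},\qquad m_{\rm drag}:=\inf_{|s|\le\bar u_{r,\max}}|X_u+2X_{u|u|}|s||,$$ and assume $m_{\rm drag}>0$. Let $u,u_c,\hat u_c\in\mathbb R$, $u_r=u-u_c$, $\hat u_r=u-\hat u_c$, $\tilde u_c=u_c-\hat u_c$, with $u,u_r,\hat u_r\in\mathcal I_u$. Suppose the surge feedforward contains the full surge damping cancellation $-(X_u\xi+X_{u|u|}\xi|\xi|)/m_u$, where $\xi$ is the surge velocity used for compensation, and let $e_{\rm ds}$ denote the residual surge disturbance after this cancellation (see context). Then: (a) (Absolute scheduling, $\xi=u$.) $$e_{\rm ds}^{\rm abs}=\frac{X_uu_c+X_{u|u|}(u|u|-u_r|u_r|)}{m_u},\qquad \frac{m_{\rm drag}}{m_u}|u_c|\le|e_{\rm ds}^{\rm abs}|\le\frac{L_{\rm drag}}{m_u}|u_c|.$$ (b) (Estimated relative scheduling, $\xi=\hat u_r$.) $$e_{\rm ds}^{\rm rel}=\frac{X_u\tilde u_c+X_{u|u|}(\hat u_r|\hat u_r|-u_r|u_r|)}{m_u},\qquad |e_{\rm ds}^{\rm rel}|\le\frac{L_{\rm drag}}{m_u}|\tilde u_c|.$$ Consequently, for $u_c\neq0$,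 $$\frac{|e_{\rm ds}^{\rm rel}|}{|e_{\rm ds}^{\rm abs}|}\le\frac{L_{\rm drag}}{m_{\rm drag}}\cdot\frac{|\tilde u_c|}{|u_c|},$$ and the strict inequality $|e_{\rm ds}^{\rm rel}|<|e_{\rm ds}^{\rm abs}|$ is guaranteed whenever $$|\tilde u_c|<\chi|u_c|,\qquad\chi:=\frac{m_{\rm drag}}{L_{\rm drag}}\in(0,1].$$ Moreover $\chi=1$ when $X_{u|u|}=0$, and $\chi\to0$ as $\bar u_{r,\max}$ grows large relative to $|X_u|/|X_{u|u|}|$.
   Context: $u$ is the surge velocity of an underwater vehicle, $u_c$ the body-frame surge component of the ocean current, $\hat u_c$ its estimate, $u_r$ the surge velocity relative to the water and $\hat u_r$ its estimate. $X_u,X_{u|u|}$ are the linear and quadratic surge damping coefficients and $m_u$ the surge inertia. The surge damping acts at the true relative velocity $u_r$, while the feedforward cancels it at the velocity $\xi$; the residual surge disturbance is by definition $$e_{\rm ds}=\frac{X_u(\xi-u_r)+X_{u|u|}(\xi|\xi|-u_r|u_r|)}{m_u},$$ written $e_{\rm ds}^{\rm abs}$ for $\xi=u$ and $e_{\rm ds}^{\rm rel}$ for $\xi=\hat u_r$. The limit statement on $\chi$ is understood within the standing requirement $m_{\rm drag}>0$. *)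

(* Defs.v *)
From mathcomp Require Import all_boot all_order all_algebra.
From mathcomp Require Import all_classical all_reals all_analysis.
Set Implicit Arguments.
Unset Strict Implicit.
Unset Printing Implicit Defensive.
Import Order.TTheory GRing.Theory Num.Theory.
Import numFieldNormedType.Exports.
Local Open Scope classical_set_scope.
Local Open Scope ring_scope.

(* Throughout, Xu and Xuu are the linear and quadratic surge damping
   coefficients X_u and X_{u|u|}, and U is the bound on the relative surge
   velocity. *)

Definition speed_interval (R : realType) (U : R) : set R :=
  [set s : R | `|s| <= U].

Definition L_drag (R : realType) (Xu Xuu U : R) : R :=
  `|Xu| + 2 * `|Xuu| * U.

(* For 0 <= U the set is nonempty and bounded below by 0, so that inf is a
   genuine infimum. *)
Definition m_drag (R : realType) (Xu Xuu U : R) : R :=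
  inf [set `|Xu + 2 * Xuu * `|s| | | s in speed_interval U].

Definition chi_drag (R : realType) (Xu Xuu U : R) : R :=
  m_drag Xu Xuu U / L_drag Xu Xuu U.

(* Residual left when the damping acting at the relative velocity ur is
   cancelled by the feedforward term - (Xu * xi + Xuu * (xi * `|xi|)) / mu
   evaluated at the velocity xi. *)
Definition e_ds (R : realType) (mu Xu Xuu xi ur : R) : R :=
  (Xu * (xi - ur) + Xuu * (xi * `|xi| - ur * `|ur|)) / mu.

(* Main.v *)
(* A difference quotient of [x |-> x * `|x|] over [-U, U] has the form [2 * s]
   with [0 <= s <= U], so the damping increment between two velocities is
   [Xu + 2 * Xuu * s] times their difference.  The modulus of that factor lies
   between [m_drag] and [L_drag].  For the limit, the point [s = 0] gives
   [m_drag <= `|Xu|], whence [chi_drag <= (1 + 2 * r)^-1] with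
   [r = U * `|Xuu| / `|Xu|]. *)
Require Import Defs.
From mathcomp Require Import all_boot all_order all_algebra.
From mathcomp Require Import lra ring.
From mathcomp Require Import all_classical all_reals all_analysis.
Set Implicit Arguments.
Unset Strict Implicit.
Unset Printing Implicit Defensive.
Import Order.TTheory GRing.Theory Num.Theory.
Import numFieldNormedType.Exports.
Local Open Scope classical_set_scope.
Local Open Scope ring_scope.

(** Since [x * |x|] has derivative [2 * |x|], the witness [s] is the mean of [|x|] over the segment
    joining [a] and [b], hence lies between 0 and [U]. For equal endpoints any such [s] works. The
    formula for the mean depends on the signs of [a] and [b]. *)
Lemma signed_square_slope (R : realFieldType) (U a b : R) :
  `|a| <= U -> `|b| <= U ->
  exists2 s, 0 <= s <= U & a * `|a| - b * `|b| = 2 * s * (a - b).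
Proof.
move=> aU bU; have U0 : 0 <= U := le_trans (normr_ge0 a) aU.
have [<-|ab] := eqVneq a b; first by exists 0; [rewrite lexx|ring].
have dab : a - b != 0 by rewrite subr_eq0.
move: aU bU; have [a0|a0] := ger0P a; have [b0|b0] := ger0P b => aU bU.
- by exists ((a + b) / 2); [apply/andP; split; lra|field].
(* Opposite signs: [a * |a| - b * |b|] is [a ^+ 2 + b ^+ 2], while [a - b] is [|a| + |b|], so the
   quotient stays below [U]. *)
- exists ((a ^+ 2 + b ^+ 2) / (2 * (a - b))); last by field.
  have d0 : 0 < 2 * (a - b) by lra.
  by rewrite ler_pdivlMr// ler_pdivrMr// mul0r; apply/andP; split; nra.
- exists ((a ^+ 2 + b ^+ 2) / (2 * (b - a))).
    have d0 : 0 < 2 * (b - a) by lra.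
    by rewrite ler_pdivlMr// ler_pdivrMr// mul0r; apply/andP; split; nra.
  by field; rewrite subr_eq0 eq_sym.
- by exists (- (a + b) / 2); [apply/andP; split; lra|field].
Qed.

Section drag_bounds.
Context {R : realType}.
Implicit Types mu Xu Xuu U s : R.

Lemma m_drag_le Xu Xuu U s :
  0 <= s <= U -> m_drag Xu Xuu U <= `|Xu + 2 * Xuu * s|.
Proof.
case/andP=> s0 sU; apply: ge_inf; first by exists 0 => _ [x _ <-].
by exists s; rewrite /speed_interval /= (ger0_norm s0).
Qed.

Lemma le_L_drag Xu Xuu U s :
  0 <= s <= U -> `|Xu + 2 * Xuu * s| <= L_drag Xu Xuu U.
Proof.
case/andP=> s0 sU; rewrite (le_trans (ler_normD _ _))// lerD2l !normrM.
by rewrite (ger0_norm s0) ger0_norm// ler_wpM2l// mulr_ge0.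
Qed.

(* On an empty velocity interval [inf] takes the value 0. *)
Lemma m_drag_gt0_bound_ge0 Xu Xuu U : 0 < m_drag Xu Xuu U -> 0 <= U.
Proof.
move=> m0; rewrite leNgt; apply/negP => U0; move: m0.
suff -> : m_drag Xu Xuu U = 0 by rewrite ltxx.
rewrite /m_drag (_ : speed_interval U = set0) ?image_set0 ?inf0//.
apply/seteqP; split => // s /= sU.
by have := le_lt_trans (le_trans (normr_ge0 s) sU) U0; rewrite ltxx.
Qed.

Lemma m_drag_le_normXu Xu Xuu U : 0 <= U -> m_drag Xu Xuu U <= `|Xu|.
Proof.
by move=> U0; have := @m_drag_le Xu Xuu U 0; rewrite mulr0 addr0 lexx; apply.
Qed.

Lemma normXu_le_L_drag Xu Xuu U : 0 <= U -> `|Xu| <= L_drag Xu Xuu U.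
Proof. by move=> U0; rewrite lerDl !mulr_ge0. Qed.

(** Covers both schedulings: [xi - ur] is [uc] for [xi = u] and [uc_tilde] for [xi = ur_hat]. *)
Lemma e_ds_bounds mu Xu Xuu U xi ur : 0 < mu -> `|xi| <= U -> `|ur| <= U ->
  m_drag Xu Xuu U / mu * `|xi - ur| <= `|e_ds mu Xu Xuu xi ur|
    <= L_drag Xu Xuu U / mu * `|xi - ur|.
Proof.
move=> mu0 xiU urU; have [s sU Es] := signed_square_slope xiU urU.
have -> : e_ds mu Xu Xuu xi ur = (Xu + 2 * Xuu * s) / mu * (xi - ur).
  by rewrite /e_ds Es; ring.
rewrite !normrM normfV (gtr0_norm mu0).
by rewrite !ler_wpM2r ?invr_ge0 ?(ltW mu0) ?m_drag_le ?le_L_drag.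
Qed.

Lemma chi_drag_le Xu Xuu U : 0 < m_drag Xu Xuu U ->
  chi_drag Xu Xuu U <= (1 + 2 * (U / (`|Xu| / `|Xuu|)))^-1.
Proof.
move=> m0; have U0 := m_drag_gt0_bound_ge0 m0.
have mX := m_drag_le_normXu Xu Xuu U0; have X0 := lt_le_trans m0 mX.
have L0 := lt_le_trans X0 (normXu_le_L_drag Xu Xuu U0).
(* This also holds at [Xuu = 0]: division by 0 yields 0, so both sides are 1. *)
suff -> : (1 + 2 * (U / (`|Xu| / `|Xuu|)))^-1 = `|Xu| / L_drag Xu Xuu U.
  by rewrite ler_wpM2r// invr_ge0 ltW.
rewrite -[RHS]invf_div; congr _^-1.
by rewrite invf_div /L_drag [RHS]mulrDl divff ?gt_eqF//; congr (_ + _); ring.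
Qed.

End drag_bounds.

Theorem lemma3 (R : realType) :
  (forall mu Xu Xuu Vdmax VcM : R,
    0 < mu -> 0 < Vdmax -> 0 < VcM ->
    let U := Vdmax + VcM in
    let L := L_drag Xu Xuu U in
    let m := m_drag Xu Xuu U in
    let chi := chi_drag Xu Xuu U in
    0 < m ->
    (forall u uc uc_hat : R,
      let ur := u - uc in
      let ur_hat := u - uc_hat in
      let uc_tilde := uc - uc_hat in
      let e_abs := e_ds mu Xu Xuu u ur in
      let e_rel := e_ds mu Xu Xuu ur_hat ur in
      speed_interval U u -> speed_interval U ur -> speed_interval U ur_hat ->
      [/\ e_abs = (Xu * uc + Xuu * (u * `|u| - ur * `|ur|)) / mu
          /\ m / mu * `|uc| <= `|e_abs| <= L / mu * `|uc|,
          e_rel = (Xu * uc_tilde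
                   + Xuu * (ur_hat * `|ur_hat| - ur * `|ur|)) / mu
          /\ `|e_rel| <= L / mu * `|uc_tilde|,
          uc != 0 -> `|e_rel| / `|e_abs| <= L / m * (`|uc_tilde| / `|uc|)
        & `|uc_tilde| < chi * `|uc| -> `|e_rel| < `|e_abs| ])
    /\ 0 < chi <= 1
    /\ (Xuu = 0 -> chi = 1))
  /\
  (forall (T : Type) (F : set_system T), Filter F ->
    forall Xu Xuu U : T -> R,
    (\forall t \near F, Xuu t != 0) ->
    (\forall t \near F, 0 < m_drag (Xu t) (Xuu t) (U t)) ->
    U t / (`|Xu t| / `|Xuu t|) @[t --> F] --> +oo ->
    chi_drag (Xu t) (Xuu t) (U t) @[t --> F] --> 0).
Proof.
split=> [mu Xu Xuu Vdmax VcM mu0 Vd0 Vc0 U L m chi m0|].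
  have U0 : 0 <= U by rewrite addr_ge0 ?ltW.
  have mX : m <= `|Xu| := m_drag_le_normXu Xu Xuu U0.
  have XL : `|Xu| <= L := normXu_le_L_drag Xu Xuu U0.
  have L0 : 0 < L := lt_le_trans m0 (le_trans mX XL).
  have chi0 : 0 < chi by rewrite divr_gt0.
  split=> [u uc uc_hat ur ur_hat uc_tilde e_abs e_rel uU urU urhU|].
    have uE : u - ur = uc by rewrite /ur; ring.
    have urE : ur_hat - ur = uc_tilde by rewrite /ur_hat /ur /uc_tilde; ring.
    have := e_ds_bounds Xu Xuu mu0 uU urU.
    rewrite uE -/m -/L -/e_abs => absB; have /andP[abs_lb _] := absB.
    have := e_ds_bounds Xu Xuu mu0 urhU urU.
    rewrite urE -/m -/L -/e_rel => /andP[_ rel_ub].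
    split.
    - by split=> //; rewrite /e_abs /e_ds uE.
    - by split=> //; rewrite /e_rel /e_ds urE.
    - move=> uc0; have nuc0 : 0 < `|uc| by rewrite normr_gt0.
      have lb0 : 0 < m / mu * `|uc| by rewrite mulr_gt0 ?divr_gt0.
      rewrite ler_pdivrMr ?(lt_le_trans lb0)//.
      apply: (le_trans rel_ub).
      (* The upper bound on [e_rel] is the claimed ratio times the lower bound on [e_abs]. *)
      have -> : L / mu * `|uc_tilde| =
          L / m * (`|uc_tilde| / `|uc|) * (m / mu * `|uc|).
        by field; rewrite !gt_eqF.
      by rewrite ler_wpM2l// !mulr_ge0 ?invr_ge0// ltW.
    - move=> small; apply: (le_lt_trans rel_ub); apply: lt_le_trans abs_lb.
      have -> : m / mu * `|uc| = L / mu * (chi * `|uc|).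
        by rewrite /chi /chi_drag -/m -/L; field; rewrite !gt_eqF.
      by rewrite ltr_pM2l ?divr_gt0.
  split; first by rewrite chi0 ler_pdivrMr// mul1r (le_trans mX XL).
  move=> Xuu0; apply/eqP; rewrite eq_le; apply/andP; split.
    by rewrite ler_pdivrMr// mul1r (le_trans mX XL).
  (* It remains to see [L <= m]: for [Xuu = 0] every element of the set defining [m] equals [|Xu|],
     which is [L]. *)
  rewrite ler_pdivlMr// mul1r; apply: lb_le_inf.
    exists `|Xu + 2 * Xuu * `|0 : R| |; exists 0 => //=.
    by rewrite /speed_interval /= normr0.
  by move=> _ [s _ <-]; rewrite /L_drag Xuu0 normr0 !(mulr0, mul0r) !addr0.
move=> T F FF Xu Xuu U _ m0 r_oo.
have bound_cvg0 : (1 + 2 * (U t / (`|Xu t| / `|Xuu t|)))^-1 @[t --> F] --> 0.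
  have den_oo : 1 + 2 * (U t / (`|Xu t| / `|Xuu t|)) @[t --> F] --> +oo.
    apply/cvgryPge => A; move/cvgryPge: r_oo => /(_ (A / 2)).
    by apply: filterS => t /= rA; lra.
  (* Inverting the limit requires an eventually positive denominator, which divergence to [+oo]
     provides. *)
  apply/gtr0_cvgV0 => //.
  by move/cvgryPgt: den_oo; apply.
apply: (squeeze_cvgr (f := fun=> 0) _ _ bound_cvg0); last exact: cvg_cst.
near=> t; rewrite chi_drag_le ?andbT; last by near: t.
have m0t : 0 < m_drag (Xu t) (Xuu t) (U t) by near: t.
(* The sign of [U t] is recovered from [m_drag] being positive; it makes [L_drag], and so
   [chi_drag], nonnegative for the squeeze. *)
have U0 := m_drag_gt0_bound_ge0 m0t.
by rewrite divr_ge0 ?(ltW m0t)// (le_trans _ (normXu_le_L_drag _ _ U0)).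
Unshelve. all: by end_near. Qed.
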